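(* Let $G$ be a connected finite simple graph with $n$ vertices and $m$ edges, and let $p_m(t)=-1+\sum_{i=0}^m a_it^i$ be the polynomial integrand in Steele's formula for the expected length of the minimal spanning tree of $G$. Then for every $i$ with $3\le i\le m$, $$a_i=\sum_{\ell=3}^{i}(-1)^{i-\ell}\binom{m-\ell}{m-i}\sum_{r=r_\ell}^{\ell-1}k_r^\ell\,(\ell-r).$$
   Context: For a finite simple graph $H$, the rank is $r(H)=|V(H)|-k(H)$, where $k(H)$ is the number of connected components of $H$. For a finite simple graph $G$, $S(G)$ denotes the set of spanning subgraphs of $G$ (subgraphs with vertex set $V(G)$ and edge set any subset of $E(G)$). The Tutte polynomial of $G$ is $$T(G;x,y)=\sum_{A\in S(G)}(x-1)^{r(G)-r(A)}(y-1)^{|E(A)|-r(A)},$$ and $T_x$ denotes its partial derivative with respect to $x$. Steele's formula says that, for a connected graph $G$ whose edges have independent lengths uniform on $[0,1]$, the expected total length of a minimal spanning tree is $\int_0^1\frac{1-t}{t}\,\frac{T_x(G;\frac1t,\frac1{1-t})}{T(G;\frac1t,\frac1{1-t})}\,dt$. The polynomial integrand $p_m(t)$, where $m=|E(G)|$, is the polynomial (of degree at most $m$) that agrees with $\frac{1-t}{t}\,\frac{T_x(G;\frac1t,\frac1{1-t})}{T(G;\frac1t,\frac1{1-t})}$ for $t\in(0,1)$. The numbers $a_i$ are defined by $p_m(t)=-1+\sum_{i=0}^m a_it^i$, i.e. $a_i$ is the coefficient of $t^i$ in $p_m(t)+1$. $k_r^\ell$ denotes the number of spanning subgraphs $A\in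 S(G)$ with exactly $\ell$ edges and rank $r$ (equivalently, with $\ell$ edges and $n-r$ connected components). $r_\ell$ denotes the minimum rank of a simple graph with $n$ vertices and $\ell$ edges; explicitly, for $\ell\ge 1$, $r_\ell$ is the largest integer $q$ with $\binom{q}{2}<\ell$. *)

(* Defs.v *)
From mathcomp Require Import all_boot all_order all_algebra.

Set Implicit Arguments.
Unset Strict Implicit.
Unset Printing Implicit Defensive.

Import Order.TTheory GRing.Theory Num.Theory.

Local Open Scope ring_scope.

(* A finite simple graph on the vertex type T is represented by its edge set:
   a set of two-element subsets of T.  Every graph considered is spanning, so
   the spanning subgraphs of E are exactly the subsets A of E. *)
Definition simple_graph (T : finType) (E : {set {set T}}) : bool :=
  [forall B in E, #|B| == 2%N].

Definition adj (T : finType) (E : {set {set T}}) : rel T :=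
  [rel x y | [set x; y] \in E].

Definition connected_graph (T : finType) (E : {set {set T}}) : Prop :=
  (0 < #|T|)%N /\ forall x y : T, connect (adj E) x y.

Definition num_components (T : finType) (E : {set {set T}}) : nat :=
  n_comp (adj E) predT.

Definition rank (T : finType) (E : {set {set T}}) : nat :=
  (#|T| - num_components E)%N.

(* The outer variable 'X is x and the inner one 'Y is y, so that the partial
   derivative with respect to x is (tutte R E)^`().  The truncated
   subtractions are exact, as rank A <= rank E and rank A <= #|A|. *)
Definition tutte (R : nzRingType) (T : finType) (E : {set {set T}}) :
    {poly {poly R}} :=
  \sum_(A : {set {set T}} | A \subset E)
    ('X - 1) ^+ (rank E - rank A) * ('Y - 1) ^+ (#|A| - rank A).

Definition steele_integrand (R : realFieldType) (T : finType)
    (E : {set {set T}}) (t : R) : R :=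
  (1 - t) / t *
  (((tutte R E)^`()).[t^-1, (1 - t)^-1] / (tutte R E).[t^-1, (1 - t)^-1]).

Definition is_polynomial_integrand (R : realFieldType) (T : finType)
    (E : {set {set T}}) (p : {poly R}) : Prop :=
  (size p <= #|E|.+1)%N /\
  forall t : R, 0 < t < 1 -> p.[t] = steele_integrand E t.

Definition num_spanning (T : finType) (E : {set {set T}}) (l r : nat) : nat :=
  #|[set A : {set {set T}} | [&& A \subset E, #|A| == l & rank A == r]]|.

(* Ranks of graphs on n vertices are at most n, so the value n is only
   returned as a default when no simple graph has n vertices and l edges. *)
Definition min_rank (n l : nat) : nat :=
  \big[minn/n]_(A : {set {set 'I_n}} | simple_graph A && (#|A| == l)) rank A.

(* Main.v *)
(* With u = t/(1-t), evaluating the Tutte polynomial at (1/t, 1/(1-t)) makes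
   every term equal to u^|A| up to the common factor u^-r(E), so the integrand
   is the sum over A of (r(E) - r(A)) t^|A| (1-t)^(m-|A|), and p is this
   polynomial.  The Bernstein identities \sum_A t^|A| (1-t)^(m-|A|) = 1 and
   \sum_A |A| t^|A| (1-t)^(m-|A|) = m t turn it into r(E) - m t plus the sum over
   A of (|A| - r(A)) t^|A| (1-t)^(m-|A|), whose coefficients are read off; graphs
   with at most two edges are forests and contribute nothing. *)

Require Import Defs.
From mathcomp Require Import all_boot all_order all_algebra.
From mathcomp Require Import zify ring.

Import Order.TTheory GRing.Theory Num.Theory.
Local Open Scope ring_scope.

(** * Components and rank *)

Lemma adj_connect_sym {T : finType} (A : {set {set T}}) : connect_sym (adj A).
Proof. by apply: sym_connect_sym => x y; rewrite /adj /= setUC. Qed.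

Lemma simple_graph_subset {T : finType} {A B : {set {set T}}} :
  A \subset B -> simple_graph B -> simple_graph A.
Proof.
by move=> /subsetP sAB /forall_inP simpB; apply/forall_inP => e /sAB/simpB.
Qed.

Lemma connect_morph {T T' : finType} {e : rel T} {e' : rel T'} {g : T' -> T} :
    {homo g : x y / e' x y >-> e x y} ->
  {homo g : x y / connect e' x y >-> connect e x y}.
Proof.
move=> g_homo x _ /connectP[p e_p ->]; elim: p x e_p => //= y p IHp x.
by move=> /andP[/g_homo/connect1 exy /IHp]; apply: connect_trans.
Qed.

Lemma num_componentsE {T : finType} (A : {set {set T}}) :
  num_components A = #|[set x | roots (adj A) x]|.
Proof. by apply: eq_card => x; rewrite !inE andbT. Qed.

(** Sending each root of [A] to the root of its image in [A'] is injective. It is used both for [A']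
    inside [A]'s supergraphs, with [f] the identity, and for moving a graph to another vertex
    type. *)
Lemma leq_num_components {T T' : finType} (A : {set {set T}})
    (A' : {set {set T'}}) (f : T -> T') :
    (forall x y, connect (adj A') (f x) (f y) -> connect (adj A) x y) ->
  (num_components A <= num_components A')%N.
Proof.
move=> f_conn; rewrite !num_componentsE.
set D := [set x | roots (adj A) x].
have inj_h: {in D &, injective (fun x => fingraph.root (adj A') (f x))}.
  move=> x y; rewrite !inE => /eqP rx /eqP ry.
  move=> /(fingraph.rootP (adj_connect_sym A'))/f_conn.
  by move=> /(fingraph.rootP (adj_connect_sym A)); rewrite rx ry.
rewrite -(card_in_imset inj_h).
apply/subset_leq_card/subsetP => _ /imsetP[x _ ->].
by rewrite inE roots_root //; apply: adj_connect_sym.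
Qed.

Lemma rankE {T : finType} (A : {set {set T}}) :
  rank A = #|[set x | fingraph.root (adj A) x != x]|.
Proof.
rewrite /rank num_componentsE -(cardsC [set x | roots (adj A) x]) addKn.
by apply: eq_card => x; rewrite !inE.
Qed.

Lemma rank_subset {T : finType} {A B : {set {set T}}} :
  A \subset B -> (rank A <= rank B)%N.
Proof.
move=> /subsetP sAB; apply/leq_sub2l/(@leq_num_components _ _ _ _ id) => x y.
by apply: connect_sub => u v /sAB; apply: connect1.
Qed.

Lemma num_components_setU1 {T : finType} (A : {set {set T}}) (x y : T) :
  (num_components A <= (num_components ([set x; y] |: A)).+1)%N.
Proof.
set A' := _ |: A; rewrite !num_componentsE.
have [symA symA'] := (adj_connect_sym A, adj_connect_sym A').
(* h merges the components of x and y, hence is constant on those of A'. *)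
pose h v := if fingraph.root (adj A) v == fingraph.root (adj A) x
            then fingraph.root (adj A) y else fingraph.root (adj A) v.
have hxy: h x = h y by rewrite /h eqxx; case: ifP.
have h_conn u v : connect (adj A') u v -> h u = h v.
  have clos: closed (adj A') [pred v | h u == h v].
    apply: intro_closed => // a b; rewrite /adj /= !inE => /orP[/eqP Eab|Aab].
      have /andP[] : (a \in [set x; y]) && (b \in [set x; y]).
        by rewrite -Eab !inE !eqxx orbT.
      by rewrite !inE => /orP[]/eqP-> /orP[]/eqP->; rewrite ?hxy.
    suff ->: h a = h b by [].
    by rewrite /h (fingraph.rootP symA (connect1 Aab)).
  by move/(closed_connect clos); rewrite !inE eqxx => /esym/eqP.
(* Only the root of [x] is discarded. On the remaining roots of [A], [h] is the identity, so they
   lie in distinct components of [A']. *)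
rewrite (cardsD1 (fingraph.root (adj A) x)) -add1n leq_add ?leq_b1 //.
set D := _ :\ _.
have inj_root: {in D &, injective (fingraph.root (adj A'))}.
  have hD v : v \in D -> h v = v.
    by rewrite !inE /h => /andP[/negPf neq_v /eqP->]; rewrite neq_v.
  by move=> u v /hD{2}<- /hD{2}<- /(fingraph.rootP symA')/h_conn.
rewrite -(card_in_imset inj_root).
apply/subset_leq_card/subsetP => _ /imsetP[v _ ->].
by rewrite inE roots_root.
Qed.

(** Induction on the number of edges: deleting an edge adds at most one component, so the rank drops
    by at most one. *)
Lemma rank_leq_card {T : finType} {A : {set {set T}}} :
  simple_graph A -> (rank A <= #|A|)%N.
Proof.
have [k] := ubnP #|A|; elim: k => // k IHk in A *; rewrite ltnS => leAk.
have [->|[B AB]] := set_0Vmem A.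
  move=> _; rewrite rankE cards0 leqn0 cards_eq0 -subset0; apply/subsetP => x.
  rewrite !inE => /negP[]; apply/eqP.
  have /connectP[p] := connect_root (adj (@set0 {set T})) x.
  by case: p => [|y p] //=; rewrite /adj /= inE.
move=> simpA; have /cards2P[x [y [_ defB]]] := forall_inP simpA B AB.
have simpA': simple_graph (A :\ B).
  by rewrite (simple_graph_subset (subD1set _ _)).
have cardA: #|A| = #|A :\ B|.+1 by rewrite (cardsD1 B) AB.
rewrite cardA in leAk *.
apply: leq_trans (_ : (rank (A :\ B)).+1 <= _)%N; last first.
  by rewrite ltnS IHk.
have := num_components_setU1 (A :\ B) x y.
rewrite -defB setD1K // /rank; lia.
Qed.

Lemma card_leq_rank {T : finType} {A : {set {set T}}} :
  simple_graph A -> (#|A| <= 2)%N -> (#|A| <= rank A)%N.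
Proof.
move=> /forall_inP simpA; rewrite leq_eqVlt ltnS rankE; set N := [set x | _].
(* If only v is not its own root, each edge is [set v; root v], so there is at
   most one edge. *)
have edgeN B : B \in A -> exists2 v, v \in N &
    (#|N| <= 1)%N -> B = [set v; fingraph.root (adj A) v].
  move=> AB; have /cards2P[x [y [neq_xy defB]]] := simpA B AB.
  have Axy: adj A x y by rewrite /adj /= -defB.
  have eq_r := fingraph.rootP (adj_connect_sym A) (connect1 Axy).
  have [rx|nrx] := eqVneq (fingraph.root (adj A) x) x.
    exists y; first by rewrite inE -eq_r rx.
    by rewrite -eq_r rx setUC.
  exists x; first by rewrite inE.
  move=> /card_le1_eqP leN1; rewrite defB eq_r; congr [set x; _].
  apply/esym/eqP/idPn => nry; case/eqP: neq_xy.
  by apply: leN1; rewrite inE.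
have N_gt0 : (0 < #|A|)%N -> (0 < #|N|)%N.
  by move=> /card_gt0P[B /edgeN[v Nv _]]; apply/card_gt0P; exists v.
case/orP=> [/eqP cA2|]; last by case: #|A| N_gt0 => [|[|]] // /(_ isT).
rewrite cA2 ltnNge; apply/negP => leN1.
move: cA2; apply/eqP; rewrite neq_ltn ltnS; apply/orP; left.
apply/card_le1_eqP => B C /edgeN[v Nv ->] // /edgeN[w Nw ->] //.
by have /card_le1_eqP/(_ v w Nv Nw)-> := leN1.
Qed.

(** Since [min_rank] ranges over graphs on ordinals, [A] is relabelled along [enum_rank]; the copy
    has as many edges and at least as many components. *)
Lemma min_rank_leq {T : finType} {A : {set {set T}}} :
  simple_graph A -> (min_rank #|T| #|A| <= rank A)%N.
Proof.
move=> /forall_inP simpA.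
pose f (B : {set T}) := [set enum_rank x | x in B].
have inj_f: injective f by apply/imset_inj/enum_rank_inj.
have f2 x y : f [set x; y] = [set enum_rank x; enum_rank y].
  by rewrite /f imsetU1 imset_set1.
apply: (@leq_trans (rank (f @: A))).
  apply: (@bigmin_le_cond _ nat _ _ _ (fun B => simple_graph B && (#|B| == #|A|))).
  rewrite card_imset // eqxx andbT; apply/forall_inP => _ /imsetP[B AB ->].
  by rewrite card_imset ?simpA //; apply: enum_rank_inj.
rewrite /rank card_ord; apply: leq_sub2l.
apply: (leq_num_components _ _ enum_rank) => x y xy.
rewrite -(enum_rankK x) -(enum_rankK y).
apply: connect_morph xy => u v.
by rewrite -{1}(enum_valK u) -{1}(enum_valK v) /adj /= -f2 (mem_imset _ _ inj_f).
Qed.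

(** * Binomial sums over subsets *)

Lemma sum_subset_card {V : nmodType} {T : finType} (E : {set T}) (F : nat -> V) :
  \sum_(A : {set T} | A \subset E) F #|A| =
  \sum_(l < #|E|.+1) F l *+ 'C(#|E|, l).
Proof.
rewrite (partition_big (fun A : {set T} => inord #|A| : 'I_#|E|.+1) predT) //=.
apply: eq_bigr => l _; rewrite -(cards_draws E l) -sumr_const.
apply: congr_big => // A; last first.
  by case/andP=> /subset_leq_card AE /eqP<-; rewrite inordK.
rewrite inE; apply: andb_id2l => /subset_leq_card AE.
by rewrite -(inj_eq val_inj) /= inordK.
Qed.

Lemma sum_bernstein {R : comNzRingType} {T : finType} (E : {set T}) (x : R) :
  \sum_(A : {set T} | A \subset E) x ^+ #|A| * (1 - x) ^+ (#|E| - #|A|) = 1.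
Proof.
rewrite (sum_subset_card E (fun l => x ^+ l * (1 - x) ^+ (#|E| - l))).
rewrite -[RHS](expr1n R #|E|) -[in RHS](subrK x 1) exprDn.
by apply: eq_bigr => l _; rewrite mulrC.
Qed.

(** The absorption identity turns [l * 'C(m, l)] into [m * 'C(m - 1, l - 1)], leaving the expansion
    of a power of [x + (1 - x) = 1]. *)
Lemma sum_bernstein_card {R : comNzRingType} {T : finType} (E : {set T}) (x : R) :
  \sum_(A : {set T} | A \subset E)
    x ^+ #|A| * (1 - x) ^+ (#|E| - #|A|) *+ #|A| = x *+ #|E|.
Proof.
rewrite (sum_subset_card E (fun l => x ^+ l * (1 - x) ^+ (#|E| - l) *+ l)).
case: #|E| => [|m]; first by rewrite big_ord1 !mulr0n.
rewrite big_ord_recl mulr0n mul0rn add0r.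
rewrite -[in RHS](mulr1 x) -[X in x * X](expr1n R m) -[in RHS](subrK x 1) exprDn.
rewrite mulr_sumr -sumrMnl; apply: eq_bigr => l _.
rewrite lift0 subSS -mulrnA -(mul_bin_diag m.+1) mulnC mulrnA; congr (_ *+ _).
by rewrite mulrnAr exprS -mulrA [x ^+ l * _]mulrC.
Qed.

(** * The integrand as a polynomial *)

Definition steele_poly (R : nzRingType) {T : finType} (E : {set {set T}}) :
    {poly R} :=
  \sum_(A : {set {set T}} | A \subset E)
    'X ^+ #|A| * (1 - 'X) ^+ (#|E| - #|A|) *+ (rank E - rank A).

Lemma horner_steele_poly {R : realFieldType} {T : finType}
    (E : {set {set T}}) (t : R) :
  simple_graph E -> 0 < t < 1 -> (steele_poly R E).[t] = steele_integrand E t.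
Proof.
move=> simpE /andP[t_gt0 t_lt1].
have t0 : t != 0 by rewrite gt_eqF.
have t1 : 1 - t != 0 by rewrite subr_eq0 gt_eqF.
pose u := t / (1 - t).
have u0 : u != 0 by rewrite mulf_neq0 ?invr_eq0.
have xE : t^-1 - 1 = u^-1 by rewrite /u; field; rewrite t0 t1.
have yE : (1 - t)^-1 - 1 = u by rewrite /u; field; rewrite t1.
have cancel_rank (A : {set {set T}}) : A \subset E ->
    u^-1 ^+ (rank E - rank A) * u ^+ (#|A| - rank A) = u ^- rank E * u ^+ #|A|.
  move=> sAE; have rAE := rank_subset sAE.
  have rA := rank_leq_card (simple_graph_subset sAE simpE).
  rewrite -{2}(subnK rAE) -{2}(subnK rA) !exprD !exprVn invfM.
  by rewrite mulrACA mulVf ?mulr1 // expf_neq0.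
have tutteE : (tutte R E).[t^-1, (1 - t)^-1] = u ^- rank E * (1 - t) ^- #|E|.
  rewrite /tutte !horner_sum.
  transitivity (u ^- rank E * \sum_(A : {set {set T}} | A \subset E) u ^+ #|A|).
    rewrite mulr_sumr; apply: eq_bigr => A sAE.
    by rewrite !hornerE /= xE yE cancel_rank.
  (* As [(1 - t)^-1 = 1 + u], the sum is the binomial expansion of its power. *)
  congr (_ * _); rewrite (sum_subset_card E (fun l => u ^+ l)).
  rewrite -exprVn -[_^-1](subrK 1) yE addrC exprDn.
  by apply: eq_bigr => l _; rewrite expr1n mul1r.
have tutte'E : (1 - t) / t * ((tutte R E)^`()).[t^-1, (1 - t)^-1] =
    u ^- rank E *
    \sum_(A : {set {set T}} | A \subset E) u ^+ #|A| *+ (rank E - rank A).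
  rewrite /tutte raddf_sum !horner_sum !mulr_sumr; apply: eq_bigr => A sAE.
  have -> : (1 - t) / t = u^-1 by rewrite /u; field; rewrite t0 t1.
  (* The second factor is constant in the outer variable, so only the first one is
     differentiated. *)
  have -> : 'Y - 1 = ('X - 1)%:P :> {poly {poly R}} by rewrite polyCB.
  rewrite -polyC_exp /= derivM derivC mulr0 addr0 deriv_exp derivB derivX.
  rewrite (derivC 1) subr0 mul1r mulrnAl !hornerMn [RHS]mulrnAr -cancel_rank //.
  (* The prefactor [u^-1] restores the power lost by differentiation; for exponent 0 both sides
     vanish. *)
  case: (rank E - rank A)%N => [|k]; first by rewrite !mulr0n mulr0.
  by rewrite !hornerE /= xE yE mulrnAr exprS mulrA.
rewrite /steele_integrand mulrA tutte'E tutteE /steele_poly horner_sum.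
rewrite invfM mulrACA divff ?invr_eq0 ?expf_neq0 // mul1r invrK mulr_suml.
apply: eq_bigr => A sAE.
have AE := subset_leq_card sAE.
rewrite hornerMn !hornerE /= mulrnAl; congr (_ *+ _).
rewrite /u expr_div_n -[in X in _ = _ * X](subnK AE) exprD.
by rewrite -[in RHS]mulrA [X in _ = _ * X]mulrCA mulVf ?mulr1 // expf_neq0.
Qed.

Lemma polynomial_integrandE {R : realFieldType} {T : finType} {E : {set {set T}}}
    {p : {poly R}} :
  simple_graph E -> is_polynomial_integrand E p -> p = steele_poly R E.
Proof.
move=> simpE [_ pE]; apply/eqP; rewrite -subr_eq0; apply/negPn/negP => q0.
(* The points [1 / (k + 2)] are distinct and lie in [(0, 1)]; there are as many as the size of the
   nonzero difference, hence more than its degree. *)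
pose s : seq R := [seq k.+2%:R^-1 | k <- iota 0 (size (p - steele_poly R E))].
have := max_poly_roots q0 (_ : all _ s) (_ : uniq s).
rewrite size_map size_iota ltnn => H; apply/notF/H.
  apply/allP => _ /mapP[k _ ->]; rewrite /root !hornerE.
  have t01 : 0 < (k.+2%:R^-1 : R) < 1.
    by rewrite invr_gt0 ltr0n invf_lt1 ?ltr0n // ltr1n.
  by rewrite pE // horner_steele_poly // subrr.
rewrite map_inj_uniq ?iota_uniq // => k l /invr_inj/eqP.
by rewrite eqr_nat => /eqP[].
Qed.

(** * Extraction of the coefficients *)

Lemma coef_bernstein {R : comNzRingType} (m l i : nat) : (l <= i <= m)%N ->
  ('X^l * (1 - 'X) ^+ (m - l) : {poly R})`_i =
  (-1) ^+ (i - l) * 'C(m - l, m - i)%:R.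
Proof.
move=> /andP[li im]; rewrite coefXnM ltnNge li /=.
have -> : 1 - 'X = 1 + (-1)%:P * 'X :> {poly R} by rewrite polyCN mulN1r.
rewrite exprDn coef_sum.
have lt_il: (i - l < (m - l).+1)%N by lia.
rewrite (bigD1 (Ordinal lt_il)) //= big1 ?addr0.
  rewrite expr1n mul1r exprMn -polyC_exp coefMn coefCM coefXn eqxx mulr1.
  by rewrite mulr_natr -bin_sub; [congr (_ *+ 'C(_, _)); lia|lia].
move=> j; rewrite -(inj_eq val_inj) /= => /negPf neq_j.
rewrite expr1n mul1r exprMn -polyC_exp coefMn coefCM coefXn eq_sym.
by rewrite neq_j mulr0 mul0rn.
Qed.

Lemma steele_polyE {R : comNzRingType} {T : finType} (E : {set {set T}}) :
    simple_graph E ->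
  steele_poly R E = (rank E)%:R - 'X *+ #|E| +
  \sum_(A : {set {set T}} | A \subset E)
    'X ^+ #|A| * (1 - 'X) ^+ (#|E| - #|A|) *+ (#|A| - rank A).
Proof.
move=> simpE; rewrite -(sum_bernstein_card E).
rewrite -[(rank E)%:R]mulr1 -[X in _ * X - _](sum_bernstein E 'X) mulr_sumr.
rewrite -sumrB -big_split /=; apply: eq_bigr => A sAE.
have rAE := rank_subset sAE.
have rA := rank_leq_card (simple_graph_subset sAE simpE).
by rewrite mulr_natl (mulrnBr _ rAE) (mulrnBr _ rA) addrA subrK.
Qed.

(** Subgraphs are grouped by rank; [min_rank_leq] shows that none falls below the range of [r]. *)
Lemma sum_num_spanning {R : pzRingType} {T : finType} (E : {set {set T}}) (l : nat) :
    simple_graph E ->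
  \sum_(min_rank #|T| l <= r < l) (num_spanning E l r)%:R * (l - r)%:R =
  \sum_(A : {set {set T}} | (A \subset E) && (#|A| == l)) (l - rank A)%:R :> R.
Proof.
move=> simpE.
transitivity (\sum_(min_rank #|T| l <= r < l)
    \sum_(A : {set {set T}} | (A \subset E) && (#|A| == l))
      if rank A == r then (l - rank A)%:R else 0 : R).
  apply: eq_bigr => r _; rewrite mulr_natl -sumr_const -big_mkcondr /=.
  apply: congr_big => // A; rewrite ?inE ?andbA //.
  by case/andP=> _ /eqP->.
rewrite exchange_big /=; apply: eq_bigr => A /andP[sAE /eqP cA].
have minA : (min_rank #|T| l <= rank A)%N.
  by rewrite -cA min_rank_leq // (simple_graph_subset sAE).
rewrite -big_mkcond /=; have [ltAl|leAl] := ltnP (rank A) l.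
  rewrite (big_rem (rank A)) /= ?eqxx ?mem_index_iota ?minA //.
  rewrite big_seq_cond big1 ?addr0 // => r.
  by rewrite mem_rem_uniq ?iota_uniq // !inE eq_sym => /andP[/andP[/negPf->]].
(* A rank of at least [l] is outside the range, but there the truncated [l - rank A] is 0. *)
rewrite (eqP leAl) big_seq_cond big1 // => r.
Qed.

Theorem theorem3p4 (R : realFieldType) (T : finType) (E : {set {set T}})
    (n m : nat) (p : {poly R})
    (simpleE : simple_graph E) (connE : connected_graph E)
    (cardT : #|T| = n) (cardE : #|E| = m)
    (pE : is_polynomial_integrand E p) (i : nat) (hi : (3 <= i <= m)%N) :
  (p + 1)`_i =
  \sum_(3 <= l < i.+1)
     (-1) ^+ (i - l) * 'C(m - l, m - i)%:R *
     \sum_(min_rank n l <= r < l) (num_spanning E l r)%:R * (l - r)%:R.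
Proof.
have /andP[i3 im] := hi.
rewrite (polynomial_integrandE simpleE pE) steele_polyE // !coefD coefN.
(* As [i] is at least 3, the constant and linear terms do not contribute. *)
rewrite !coefMn coefX !coef1 !gtn_eqF ?mul0rn; try lia.
rewrite subr0 addr0 add0r coef_sum -cardE -cardT.
transitivity (\sum_(0 <= l < i.+1)
    \sum_(A : {set {set T}} | (A \subset E) && (#|A| == l))
      (-1) ^+ (i - l) * 'C(#|E| - l, #|E| - i)%:R * (l - rank A)%:R : R).
  rewrite (exchange_big_dep (fun A : {set {set T}} => A \subset E)) /=; last first.
    by move=> ? ? _ /andP[].
  apply: eq_bigr => A sAE.
  rewrite coefMn big_mkcond /=.
  under eq_bigr => l _ do rewrite sAE /=.
  (* If [A] has more than [i] edges, its term is divisible by a power of ['X] above [i], so sizes up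
     to [i] suffice. *)
  have [ltiA|leAi] := ltnP i #|A|.
    rewrite coefXnM ltiA mul0rn big_nat big1 // => l /andP[_ lei].
    by case: eqP => // cA; move: ltiA; rewrite cA; lia.
  rewrite coef_bernstein ?leAi ?cardE // -cardE.
  rewrite (bigD1_seq #|A|) ?iota_uniq ?mem_index_iota //= eqxx big1 ?addr0 ?mulr_natr //.
  by move=> l; rewrite eq_sym => /negPf->.
(* For [l < 3], [card_leq_rank] makes each [l - rank A] zero. *)
rewrite (big_cat_nat (n := 3)) //=; last by lia.
rewrite big_nat big1 ?add0r => [|l /andP[_ l3]].
  by apply: eq_bigr => l _; rewrite -mulr_sumr sum_num_spanning.
apply: big1 => A /andP[sAE /eqP cA].
have := card_leq_rank (simple_graph_subset sAE simpleE); rewrite cA => /(_ l3).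
by rewrite -subn_eq0 => /eqP->; rewrite mulr0.
Qed.
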